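(* The class of $G$-freeness properties, with $G$ ranging over simple graphs, contains infinitely many distinct properties. In particular: 1. For every odd $k\ge 3$, if $f:\{0,1\}^n\to\{0,1\}$ is $C_{k+2}$-free, then $f$ is also $C_k$-free. Conversely, there exist functions that are $C_k$-free but far from being $C_{k+2}$-free: there is a constant $\delta>0$ depending only on $k$ such that for all sufficiently large $n$ there is $g:\{0,1\}^n\to\{0,1\}$ that is $C_k$-free and $\delta$-far from being $C_{k+2}$-free. 2. For positive integers $k\le\ell$, if $f:\{0,1\}^n\to\{0,1\}$ is $K_k$-free, then it is also $K_\ell$-free. On the other hand, if $k\ge 3$ and $\ell\ge\binom{k}{2}+2$, then there exist functions that are $K_\ell$-free but far from being $K_k$-free: there is a constant $\delta>0$ depending only on $k$ such that for all sufficiently large $n$ there is $g:\{0,1\}^n\to\{0,1\}$ that is $K_\ell$-free and $\delta$-far from being $K_k$-free.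
   Context: $\{0,1\}$ is identified with the field $\mathbb{F}_2$, and $\{0,1\}^n$ with the vector space $\mathbb{F}_2^n$; linear means $\mathbb{F}_2$-linear. $C_k$ is the cycle on $k$ vertices, $K_k$ the complete graph on $k$ vertices. Let $G$ be a simple graph with $m$ edges. The graphic matroid of $G$ is represented by vectors $v_1,\ldots,v_m\in\{0,1\}^m$, in bijection with the edges of $G$, such that a subset of them is linearly dependent if and only if the associated set of edges contains a cycle. A function $f:\{0,1\}^n\to\{0,1\}$ is $G$-free if for every linear map $L:\{0,1\}^m\to\{0,1\}^n$, $\langle f(L(v_1)),\ldots,f(L(v_m))\rangle\ne 1^m$ (this does not depend on the choice of representation). The property of $G$-freeness consists of the family of $G$-free functions on $\{0,1\}^n$ for every positive integer $n$. For $f,g:\{0,1\}^n\to\{0,1\}$, $\delta(f,g)=\Pr_x[f(x)\ne g(x)]$ with $x$ uniform in $\{0,1\}^n$; $f$ is $\delta$-far from a family $\mathcal{F}$ if $\delta(f,g)\ge\delta$ for every $g\in\mathcal{F}$. *)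

(* Defs.v *)
From HB Require Import structures.
From mathcomp Require Import all_boot all_order all_algebra.
From mathcomp Require Import classical_sets cardinality reals.

Set Implicit Arguments.
Unset Strict Implicit.
Unset Printing Implicit Defensive.

Import Order.TTheory GRing.Theory Num.Theory.

Local Open Scope ring_scope.

Record sgraph := SGraph {
  vertex : finType;
  adj : rel vertex;
  adj_sym : symmetric adj;
  adj_irrefl : irreflexive adj }.

Definition edges (G : sgraph) : {set {set vertex G}} :=
  [set [set p.1; p.2] | p in [pred p | adj p.1 p.2]].

(* [S] is a set of edges, each a two-element set of vertices.  A cycle is
   given by its cyclic sequence of at least three distinct vertices. *)
Definition contains_cycle (V : finType) (S : {set {set V}}) : Prop :=
  exists2 p : seq V, (2 < size p)%N & ucycle (fun x y => [set x; y] \in S) p.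

(* The vectors form a family indexed by the edges; the values of [v] outside
   [edges G] are irrelevant.  As two edges of a simple graph never contain a
   cycle, such a [v] is automatically injective on [edges G]. *)
Definition represents (G : sgraph)
    (v : {set vertex G} -> 'rV['F_2]_#|edges G|) : Prop :=
  forall S : {set {set vertex G}}, S \subset edges G ->
    (~~ free [seq v e | e <- enum S]) <-> contains_cycle S.

Definition boolfun (n : nat) := {ffun 'rV['F_2]_n -> 'F_2}.

(* All representations give the same notion, since a binary matroid has a
   unique representation over F_2 up to linear isomorphism of the span. *)
Definition Gfree (G : sgraph) (n : nat) (f : boolfun n) : Prop :=
  forall v : {set vertex G} -> 'rV['F_2]_#|edges G|, represents v ->
  forall L : {linear 'rV['F_2]_#|edges G| -> 'rV['F_2]_n},
    ~ (forall e, e \in edges G -> f (L (v e)) = 1).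

Definition property := set {n : nat & boolfun n}.

Definition freeness (G : sgraph) : property :=
  [set f | (0 < tag f)%N /\ Gfree G (tagged f)]%classic.

Definition cycle_adj (k : nat) : rel 'I_k :=
  fun x y => (x != y) && ((y == ordS x) || (x == ordS y)).

Lemma cycle_adj_sym k : symmetric (@cycle_adj k).
Proof. by move=> x y; rewrite /cycle_adj eq_sym orbC. Qed.

Lemma cycle_adj_irrefl k : irreflexive (@cycle_adj k).
Proof. by move=> x; rewrite /cycle_adj eqxx. Qed.

(* The cycle C_k when 3 <= k. *)
Definition cycle_graph (k : nat) : sgraph :=
  SGraph (@cycle_adj_sym k) (@cycle_adj_irrefl k).

Definition complete_adj (k : nat) : rel 'I_k := fun x y => x != y.

Lemma complete_adj_sym k : symmetric (@complete_adj k).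
Proof. by move=> x y; rewrite /complete_adj eq_sym. Qed.

Lemma complete_adj_irrefl k : irreflexive (@complete_adj k).
Proof. by move=> x; rewrite /complete_adj eqxx. Qed.

Definition complete_graph (k : nat) : sgraph :=
  SGraph (@complete_adj_sym k) (@complete_adj_irrefl k).

Definition dist (R : realType) (n : nat) (f g : boolfun n) : R :=
  #|[set x | f x != g x]|%:R / #|{: 'rV['F_2]_n}|%:R.

Definition far (R : realType) (n : nat) (delta : R) (f : boolfun n)
    (F : set (boolfun n)) : Prop :=
  forall g : boolfun n, F g -> delta <= dist R f g.

(* Main.v *)
Require Import Defs.
From HB Require Import structures.
From mathcomp Require Import classical_sets cardinality reals.
From mathcomp Require Import all_boot all_order all_algebra zify.

Set Implicit Arguments.
Unset Strict Implicit.
Unset Printing Implicit Defensive.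

Import Order.TTheory GRing.Theory Num.Theory.

Local Open Scope ring_scope.

(** Linear maps applied to a representation of the graphic matroid of [G] are
    the same as vertex potentials: [f] is [G]-free iff there is no [phi] from
    the vertices to F_2^n with [f (phi x + phi y) = 1] on all edges, in other
    words no homomorphism from [G] to the Cayley graph of F_2^n on the support
    of [f] ([GfreeP]).  Behind this are two facts: the incidence vectors of the
    edges represent the graphic matroid ([incidence_cycle]), and a binary
    matroid has a unique representation ([zero_sum_transfer]).

    The inclusions between properties follow by composing with homomorphisms of
    graphs ([Gfree_hom]): C_(k+2) folds onto C_k, and K_k embeds in K_l.

    For the separations, fix a graph [G] with d vertices and let [universal G]
    be the indicator of the vectors whose first d coordinates form e_x + e_y for
    an edge {x, y}.  Unit vectors give a homomorphism from [G], and it stays one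
    under arbitrary changes of the other coordinates of its values.  Averaging
    over these changes, a [G]-free function must differ from [universal G] on
    at least a fraction 1 / (2^d d^2) of all points ([universal_far]).  On the
    other hand, few other graphs have homomorphisms into [universal G].  If [G]
    is C_(k+2), an odd closed walk of length [k] is excluded by parity
    ([universal_cycle_free]).  If [G] is K_k, a clique on 'C(k, 2) + 2 vertices
    is excluded because the differences from one of its vertices would give
    'C(k, 2) + 1 distinct edges of K_k ([universal_complete_free]).  The odd
    cycles give infinitely many properties, as these form a strictly decreasing
    chain ([odd_cycle_freeness_inj]). *)

(** * Linear dependence over the two-element field *)

Lemma F2_neq0 (a : 'F_2) : (a != 0) = (a == 1).
Proof. by case: a => [[|[|]]]. Qed.

Lemma addrr_F2 n (x : 'rV['F_2]_n) : x + x = 0.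
Proof.
by apply/rowP => i; rewrite !mxE (addrr_pchar2 (pchar_Fp (isT : prime 2))).
Qed.

Lemma addr_eq0_F2 n (x y : 'rV['F_2]_n) : (x + y == 0) = (x == y).
Proof. by rewrite -(inj_eq (addIr y)) -addrA addrr_F2 addr0 add0r. Qed.

Lemma addKr_F2 n (x y z : 'rV['F_2]_n) : (x + y) + (y + z) = x + z.
Proof. by rewrite addrA -(addrA x) addrr_F2 addr0. Qed.

Lemma extend_from_enum (I : finType) (A : {set I}) (T : Type) (x0 : T)
    (k : 'I_#|A| -> T) :
  exists k' : I -> T, forall j, k' (enum_val j) = k j.
Proof.
exists (fun i => if [pick j | enum_val j == i] is Some j then k j else x0) => j.
by case: pickP => [j' /eqP/enum_val_inj-> //|/(_ j)]; rewrite eqxx.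
Qed.

Section Dependence.
Variables (I : finType) (n : nat).
Implicit Types (v : I -> 'rV['F_2]_n) (S T : {set I}).

Definition dependent v S : Prop :=
  exists T, [/\ T \subset S, T != set0 & \sum_(i in T) v i = 0].

Lemma sum_F2_support v S (k : I -> 'F_2) :
  \sum_(i in S) k i *: v i = \sum_(i in [set i in S | k i == 1]) v i.
Proof.
rewrite (bigID (fun i => k i == 1)) /= [X in _ + X]big1 ?addr0.
  by apply: eq_big => [i|i /andP[_ /eqP->]]; rewrite ?inE ?scale1r.
by move=> i /andP[_]; rewrite -F2_neq0 negbK => /eqP->; rewrite scale0r.
Qed.

(** Over F_2 a linear combination is the sum of a subset, namely of its
    support; [free] speaks of the list of values, and [enum_val] indexes it. *)
Lemma dependentP v S : ~~ free [seq v i | i <- enum S] <-> dependent v S.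
Proof.
have sz : size [seq v i | i <- enum S] == #|S| by rewrite size_map -cardE.
have nthX (j : 'I_#|S|) : [seq v i | i <- enum S]`_j = v (enum_val j).
  by rewrite (nth_map (enum_val j)) -?cardE // -enum_val_nth.
pose X := Tuple sz; split=> [/negP nfree | [T [sTS /set0Pn[i Ti] sumT]]].
- case: (boolP [exists T : {set I},
      [&& T \subset S, T != set0 & \sum_(i in T) v i == 0]]).
    by case/existsP=> T /and3P[? ? /eqP ?]; exists T.
  move/existsPn=> noT; case: nfree; apply/(@freeP _ _ _ X) => k sumk j.
  apply/eqP; apply: contraT => kj.
  have [k' k'E] := extend_from_enum 0 k.
  have := noT [set i in S | k' i == 1].
  rewrite -sum_F2_support big_enum_val /=.
  under eq_bigr => j' _ do rewrite k'E -nthX.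
  rewrite sumk eqxx andbT negb_and negbK; case/orP => [/negP[]|].
    by apply/subsetP => i; rewrite inE => /andP[].
  move/eqP/setP/(_ (enum_val j)); rewrite !inE k'E -F2_neq0 kj.
  by rewrite enum_valP.
- apply/negP => /(@freeP _ _ _ X) fr.
  have Si := subsetP sTS i Ti.
  suff /(_ (enum_rank_in Si i)) :
      forall j : 'I_#|S|, (enum_val j \in T)%:R = 0 :> 'F_2.
    by rewrite enum_rankK_in // Ti.
  apply: fr; under eq_bigr => j _ do rewrite /= nthX.
  rewrite -(big_enum_val (fun i => (i \in T)%:R *: v i)) sum_F2_support.
  rewrite -[RHS]sumT; apply: eq_bigl => i'; rewrite inE.
  by case: (boolP (i' \in T)) => [/(subsetP sTS)->|_]; rewrite ?andbF.
Qed.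

Lemma sum_setD v S T : T \subset S -> \sum_(i in T) v i = 0 ->
  \sum_(i in S :\: T) v i = \sum_(i in S) v i.
Proof.
by move=> /setIidPr ST T0; rewrite [RHS](big_setID T) /= ST T0 add0r.
Qed.

(** In characteristic 2, a second copy of [v i] cancels the first. *)
Lemma sum_toggle v i T : exists T',
  T' \subset i |: T /\ \sum_(j in T') v j = v i + \sum_(j in T) v j.
Proof.
case: (boolP (i \in T)) => Ti; last by exists (i |: T); rewrite big_setU1.
exists (T :\ i); rewrite (big_setD1 i Ti) addrA addrr_F2 add0r.
by split=> //; apply/subsetP=> j; rewrite !inE orbC => /andP[_ ->].
Qed.

End Dependence.

(** A binary matroid has only one representation over F_2 up to isomorphism.
    If [D] is a minimal nonempty set on which [w] sums to zero, then [D] is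
    dependent for [v], hence contains a nonempty set on which [v] sums to zero;
    that set is dependent for [w], so by minimality it is all of [D].  Thus the
    minimal zero-sum sets agree, and every zero-sum set is peeled into them. *)
Lemma zero_sum_transfer (I : finType) n p (v : I -> 'rV['F_2]_n)
    (w : I -> 'rV['F_2]_p) (E : {set I}) :
  (forall S : {set I}, S \subset E -> dependent v S <-> dependent w S) ->
  forall T : {set I}, T \subset E ->
    \sum_(i in T) w i = 0 -> \sum_(i in T) v i = 0.
Proof.
move=> dep T; have [m] := ubnP #|T|; elim: m T => // m IH T lt_Tm TE wT0.
have [->|T0] := eqVneq T set0; first by rewrite big_set0.
pose P (D : {set I}) := (D != set0) && (\sum_(i in D) w i == 0).
have /minset_exists[D /minsetP[/andP[D0 /eqP wD0] minD] DT] : P T.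
  by rewrite /P T0 wT0 eqxx.
have DE := subset_trans DT TE.
have /(dep D DE)[D' [D'D D'0 vD']] : dependent w D by exists D.
have /(dep D' (subset_trans D'D DE))[D'' [D''D' D''0 wD'']] :
  dependent v D' by exists D'.
have eqD : D'' = D.
  apply: minD; last exact: subset_trans D'D.
  by rewrite /P D''0 wD'' eqxx.
have {D'' D''D' D''0 wD'' eqD} eqD' : D' = D.
  by apply/eqP; rewrite eqEsubset D'D -eqD.
rewrite eqD' in vD'; rewrite -(sum_setD DT vD'); apply: IH.
- apply: leq_trans (_ : #|T| <= m)%N => //; apply: proper_card.
  rewrite properE subsetDl; apply: contra D0 => sTD.
  rewrite -subset0; apply/subsetP => i Di.
  by have := subsetP sTD i (subsetP DT i Di); rewrite !inE Di.
- exact: subset_trans (subsetDl _ _) TE.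
- by rewrite (sum_setD DT wD0).
Qed.

(** * Incidence vectors represent the graphic matroid *)

Section Incidence.
Variable V : finType.
Implicit Types (x y z : V) (e : {set V}) (S T : {set {set V}}) (p q : seq V).

Definition incidence (e : {set V}) : 'rV['F_2]_#|V| :=
  \row_i (enum_val i \in e)%:R.

Definition vertex_vector x := incidence [set x].

Lemma incidence_coord e x : incidence e 0 (enum_rank x) = (x \in e)%:R.
Proof. by rewrite mxE enum_rankK. Qed.

Lemma incidence_pair x y :
  x != y -> incidence [set x; y] = vertex_vector x + vertex_vector y.
Proof.
move=> xy; apply/rowP => i; rewrite !mxE !inE.
by case: eqVneq => [->|_]; rewrite ?(negbTE xy) ?addr0 ?add0r.
Qed.

(** The endpoints of a walk telescope.  The set [T] may be smaller than the set
    of edges of the walk, since edges used twice cancel. *)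
Lemma path_incidence S x p :
    (forall e : {set V}, e \in S -> #|e| = 2%N) ->
    path (fun x y => [set x; y] \in S) x p ->
  exists2 T : {set {set V}}, T \subset S &
    \sum_(e in T) incidence e = vertex_vector x + vertex_vector (last x p).
Proof.
move=> S2; elim: p x => [|y p IH] x /=.
  by exists set0; rewrite ?sub0set // big_set0 addrr_F2.
case/andP=> Sxy /IH[T TS sumT].
have [T' [sT' sumT']] := sum_toggle incidence [set x; y] T.
exists T'; first by rewrite (subset_trans sT') // subUset sub1set Sxy.
have xy : x != y by move/S2: Sxy; rewrite cards2; case: eqP.
by rewrite sumT' sumT incidence_pair // addKr_F2.
Qed.

(** On a cycle x, y, z, ..., x, the walk from z back to x avoids y, so the two
    edges at y do not cancel against it: together with the edges that this walk
    contributes they form a nonempty set with sum zero. *)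
Lemma cycle_dependent S : (forall e : {set V}, e \in S -> #|e| = 2%N) ->
  contains_cycle S -> dependent incidence S.
Proof.
move=> S2 [[|x [|y [|z q]]] // _ /andP[]]; rewrite [cycle _ _]/=.
case/and3P=> Sxy Syz pz /andP[x_notin /andP[y_notin _]].
pose S' := [set e in S | y \notin e].
have S'S : S' \subset S by apply/subsetP=> e; rewrite inE => /andP[].
have {}pz : path (fun x y => [set x; y] \in S') z (rcons q x).
  apply: (@sub_in_path _ (predC1 y)) pz => [a b|].
    rewrite !inE => ay yb ->.
    by rewrite !(eq_sym y) negb_or ay yb.
  apply/allP=> a; rewrite -rcons_cons mem_rcons inE /= => /orP[/eqP->|qa].
    by move: x_notin; rewrite inE negb_or => /andP[].
  by apply: contraNneq y_notin => <-.
have [T TS'] := path_incidence (fun e eS' => S2 e (subsetP S'S e eS')) pz.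
rewrite last_rcons => sumT.
have notT (e : {set V}) : y \in e -> e \notin T.
  by move=> ye; apply: contraL ye => /(subsetP TS'); rewrite inE => /andP[].
have xz : [set x; y] != [set y; z].
  apply: contraNneq x_notin => /setP/(_ x).
  by rewrite !inE eqxx => /esym; rewrite orbA => ->.
have [xy yz] : x != y /\ y != z.
  by split; [move/S2: Sxy|move/S2: Syz]; rewrite cards2; case: eqP.
exists ([set x; y] |: ([set y; z] |: T)); split.
- rewrite !subUset !sub1set Sxy Syz; exact: subset_trans TS' S'S.
- by apply/set0Pn; exists [set x; y]; rewrite setU11.
- rewrite big_setU1 ?inE ?negb_or ?xz ?notT ?inE ?eqxx ?orbT //=.
  rewrite big_setU1 ?notT ?inE ?eqxx //= sumT !incidence_pair //.
  by rewrite !addKr_F2 addrr_F2.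
Qed.

(** Incidence vectors of [T] sum to zero exactly when all degrees in [T] are
    even, and an even positive degree is at least two. *)
Lemma zero_sum_degree T x e : \sum_(e in T) incidence e = 0 ->
  e \in T -> x \in e -> exists2 e', e' \in T :\ e & x \in e'.
Proof.
move=> /rowP/(_ (enum_rank x)) sum0 Te ex.
case: (pickP [pred e' | (e' \in T :\ e) && (x \in e')]) => [e' /andP[]|no].
  by exists e'.
move: sum0; rewrite summxE (big_setD1 e) //= incidence_coord ex big1 ?addr0.
  by rewrite mxE.
move=> e' Te'; rewrite incidence_coord.
by move: (no e'); rewrite /= Te' /= => ->.
Qed.

(** A path in a graph without vertices of degree one can be prolonged at its
    first vertex until it meets itself. *)
Lemma path_cycle T x y q :
    (forall e : {set V}, e \in T -> #|e| = 2%N) ->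
    \sum_(e in T) incidence e = 0 ->
    uniq [:: x, y & q] -> path (fun x y => [set x; y] \in T) x (y :: q) ->
  contains_cycle T.
Proof.
move=> T2 sumT; have [m] := ubnP (#|V| - size q).
elim: m x y q => // m IH x y q ltm uq /= /andP[Txy pyq].
(* the degree of [x] is even, so the edge to [y] is not the only one *)
have [e' /setD1P[e'xy Te'] xe'] := zero_sum_degree sumT Txy (set21 x y).
have /eqP/cards2P[a [b [ab def_e']]] := T2 e' Te'.
have [z zx def_e] : exists2 z, z != x & e' = [set z; x].
  move: xe'; rewrite def_e' !inE => /orP[/eqP->|/eqP->].
    by exists b; rewrite 1?eq_sym // setUC.
  by exists a.
have zy : z != y by apply: contraNneq e'xy => <-; rewrite def_e setUC.
(* either [z] extends the path, or the path returns to [z] and closes up *)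
have [qz|qz] := boolP (z \in q); last first.
  apply: (IH z x (y :: q)) => /=.
  - rewrite -ltnS (leq_trans _ ltm) // ltnS subnS prednK // subn_gt0.
    apply: ltnW; rewrite cardE (uniq_leq_size uq) // => v _.
    by rewrite mem_enum.
  - by move: uq => /= ->; rewrite !inE !negb_or zx zy qz.
  - by rewrite -def_e Te' Txy pyq.
case/splitPr: qz uq pyq {ltm} => q1 q2; rewrite -cat_rcons => uq pyq.
exists (x :: y :: rcons q1 z); first by rewrite /= size_rcons.
apply/andP; split.
  move: pyq; rewrite cat_path => /andP[pyq _].
  by rewrite /= Txy rcons_path pyq last_rcons -def_e.
by move: uq; rewrite -!cat_cons cat_uniq => /andP[].
Qed.

Lemma dependent_cycle S : (forall e : {set V}, e \in S -> #|e| = 2%N) ->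
  dependent incidence S -> contains_cycle S.
Proof.
move=> S2 [T [TS /set0Pn[e Te] sumT]].
have T2 e' Te' := S2 e' (subsetP TS e' Te').
have /eqP/cards2P[x [y [xy def_e]]] := T2 e Te.
have [p szp /andP[cp up]] : contains_cycle T.
  by apply: (@path_cycle T x y [::]) => //=; rewrite ?inE ?andbT // -def_e.
exists p => //; rewrite /ucycle up andbT.
by apply: sub_cycle cp => a b; apply: (subsetP TS).
Qed.

End Incidence.

(** * Freeness as absence of homomorphisms to a Cayley graph *)

Section Cayley.
Variable G : sgraph.
Local Notation V := (vertex G).
Local Notation E := (edges G).

Lemma card_edge (e : {set V}) : e \in E -> #|e| = 2%N.
Proof.
case/imsetP=> -[x y]; rewrite inE /= => xy ->.
by rewrite cards2; case: eqVneq xy => // ->; rewrite adj_irrefl.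
Qed.

Lemma adj_neq (x y : V) : adj x y -> x != y.
Proof. by apply: contraTneq => ->; rewrite adj_irrefl. Qed.

Lemma mem_edge (x y : V) : adj x y -> [set x; y] \in E.
Proof. by move=> xy; apply/imsetP; exists (x, y). Qed.

Lemma incidence_cycle (S : {set {set V}}) : S \subset E ->
  dependent (@incidence V) S <-> contains_cycle S.
Proof.
move=> SE; have S2 e (Se : e \in S) := card_edge (subsetP SE e Se).
by split; [exact: dependent_cycle | exact: cycle_dependent].
Qed.

Definition incidence_mx : 'M['F_2]_(#|E|, #|V|) :=
  \matrix_i incidence (enum_val i).

(** Homomorphisms from [G] to the Cayley graph of F_2^n whose connection set is
    the support of [f].  Loops are possible: [f 0 = 1] is allowed. *)
Definition hom_into n (f : boolfun n) (phi : V -> 'rV['F_2]_n) : Prop :=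
  forall x y, adj x y -> f (phi x + phi y) = 1.

(** By uniqueness of binary representations, every linear relation between the
    incidence vectors also holds between the [v e], hence between the [L (v e)].
    So incidence vectors determine the [L (v e)] linearly, and the image of the
    unit vector of a vertex is the potential sought. *)
Lemma hom_of_representation n (v : {set V} -> 'rV['F_2]_#|E|)
    (L : {linear 'rV['F_2]_#|E| -> 'rV['F_2]_n}) :
  represents v ->
  exists phi : V -> 'rV['F_2]_n,
    forall x y, adj x y -> phi x + phi y = L (v [set x; y]).
Proof.
move=> rep_v; pose Y : 'M['F_2]_(#|E|, n) := \matrix_i L (v (enum_val i)).
have zero_sum (T : {set {set V}}) : T \subset E ->
    \sum_(e in T) incidence e = 0 -> \sum_(e in T) v e = 0.
  apply: zero_sum_transfer => S SE; rewrite incidence_cycle // -dependentP.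
  exact: rep_v.
have kerY (k : 'rV_#|E|) : k *m incidence_mx = 0 -> k *m Y = 0.
  have [k' k'E] := extend_from_enum 0 (k 0).
  have sumE p (w : {set V} -> 'rV['F_2]_p) :
      k *m (\matrix_i w (enum_val i)) =
      \sum_(e in [set e in E | k' e == 1]) w e.
    rewrite mulmx_sum_row -sum_F2_support [RHS]big_enum_val.
    by apply: eq_bigr => j _; rewrite rowK k'E.
  rewrite (sumE _ (@incidence V)) (sumE _ (L \o v)) -linear_sum => /zero_sum->.
    by rewrite linear0.
  by apply/subsetP=> e; rewrite inE => /andP[].
have /submxP[A defYT] : (Y^T <= incidence_mx^T)%MS.
  have cokerM : (cokermx incidence_mx^T)^T *m incidence_mx = 0.
    by apply: trmx_inj; rewrite trmx_mul trmxK mulmx_coker trmx0.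
  rewrite submxE -trmx_eq0 trmx_mul trmxK; apply/eqP/row_matrixP => i.
  by rewrite row_mul kerY ?row0 // -row_mul cokerM row0.
have {defYT} defY : Y = incidence_mx *m A^T.
  by rewrite -[LHS]trmxK defYT trmx_mul trmxK.
exists (fun x => vertex_vector x *m A^T) => x y xy.
have exy := mem_edge xy.
have /rowP : row (enum_rank_in exy [set x; y]) Y = L (v [set x; y]).
  by rewrite rowK enum_rankK_in.
rewrite defY row_mul rowK enum_rankK_in // incidence_pair ?adj_neq //.
by rewrite mulmxDl => /rowP.
Qed.

(** Incidence vectors live in F_2^V and must be moved to F_2^E, whatever the
    relative sizes.  If [M] is the incidence matrix, then the rows of
    [M *m pinvmx M] have the right length, and multiplication by [M] recovers
    the incidence vectors, so no linear relation is gained or lost. *)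
Lemma representation_of_hom n (phi : V -> 'rV['F_2]_n) :
  exists2 v : {set V} -> 'rV['F_2]_#|E|, represents v &
  exists L : {linear 'rV['F_2]_#|E| -> 'rV['F_2]_n},
    forall x y, adj x y -> L (v [set x; y]) = phi x + phi y.
Proof.
pose v e := incidence e *m pinvmx incidence_mx.
have vK e : e \in E -> v e *m incidence_mx = incidence e.
  move=> Ee; rewrite mulmxKpV // -[e](enum_rankK_in Ee) //.
  by rewrite -(rowK (fun i => incidence (enum_val i))) row_sub.
exists v.
  move=> S SE; rewrite dependentP -incidence_cycle //.
  split=> -[T [TS T0 sumT]]; exists T; split=> //.
    have : (\sum_(e in T) v e) *m incidence_mx = 0 by rewrite sumT mul0mx.
    rewrite mulmx_suml => M0; rewrite -[RHS]M0; apply: eq_bigr => e Te.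
    by rewrite vK // (subsetP SE) // (subsetP TS).
  by rewrite -mulmx_suml sumT mul0mx.
pose Phi : 'M['F_2]_(#|V|, n) := \matrix_i phi (enum_val i).
have PhiE x : vertex_vector x *m Phi = phi x.
  rewrite mulmx_sum_row (bigD1 (enum_rank x)) //= incidence_coord inE eqxx.
  rewrite scale1r rowK enum_rankK big1 ?addr0 // => i ix.
  rewrite -[i]enum_valK incidence_coord inE (_ : _ == _ = false) ?scale0r //.
  by apply: contra_neqF ix => /eqP <-; rewrite enum_valK.
exists (mulmxr (incidence_mx *m Phi)) => x y xy /=.
by rewrite mulmxA vK ?mem_edge // incidence_pair ?adj_neq // mulmxDl !PhiE.
Qed.

(** The linear maps of the definition are exactly the potentials on vertices:
    this removes matroid representations from the rest of the argument. *)
Lemma GfreeP n (f : boolfun n) : Gfree G f <-> ~ exists phi, hom_into f phi.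
Proof.
split=> [free_f [phi hom_phi] | nohom v rep_v L Lv].
  have [v rep_v [L Lv]] := representation_of_hom phi.
  apply: (free_f v rep_v L) => e /imsetP[[x y]]; rewrite inE /= => xy ->.
  by rewrite Lv // hom_phi.
have [phi phiE] := hom_of_representation L rep_v.
by case: nohom; exists phi => x y xy; rewrite phiE // Lv // mem_edge.
Qed.

End Cayley.

Lemma Gfree_hom (G H : sgraph) (h : vertex G -> vertex H) n (f : boolfun n) :
  (forall x y, adj x y -> adj (h x) (h y)) -> Gfree G f -> Gfree H f.
Proof.
move=> hom_h /GfreeP free_f; apply/GfreeP => -[phi hom_phi].
by apply: free_f; exists (phi \o h) => x y /hom_h; apply: hom_phi.
Qed.

(** * The universal function of a graph and its distance to freeness *)

Section Universal.
Variable G : sgraph.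
Local Notation V := (vertex G).
Local Notation d := #|V|.

(** The support consists of the vectors whose first [d] coordinates are the
    incidence vector of an edge, so that sending each vertex to its unit vector
    is a homomorphism.  When [d <= n], [pid_mx d] with [n] rows truncates to the
    first [d] coordinates, and with [d] rows it pads by zeros. *)
Definition universal n : boolfun n :=
  [ffun z : 'rV['F_2]_n => [exists p : V * V, adj p.1 p.2 &&
    (z *m pid_mx d == vertex_vector p.1 + vertex_vector p.2)]%:R].

Lemma universal_eq1 n (z : 'rV['F_2]_n) :
  universal n z = 1 <-> exists x y : V, adj x y /\
    z *m pid_mx d = vertex_vector x + vertex_vector y.
Proof.
rewrite ffunE; split.
  by case: existsP => // -[[x y] /andP[/= xy /eqP zE]] _; exists x, y.
move=> [x [y [xy zE]]].
suff -> : [exists p : V * V, adj p.1 p.2 &&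
  (z *m pid_mx d == vertex_vector p.1 + vertex_vector p.2)] by [].
by apply/existsP; exists (x, y); rewrite /= xy zE eqxx.
Qed.

Section Averaging.
Variables (n : nat) (leVn : (d <= n)%N).

Local Notation head := (pid_mx d : 'M['F_2]_(n, d)).
Local Notation pad := (pid_mx d : 'M['F_2]_(d, n)).

(** The projection onto the kernel of the truncation to [d] coordinates. *)
Let ker_proj : 'M['F_2]_n := 1%:M - head *m pad.

(** The unit-vector homomorphism, moved inside the fibres of the truncation by
    arbitrary vectors [kappa]: all of these are homomorphisms into
    [universal]. *)
Let hom_perturb (kappa : {ffun V -> 'rV['F_2]_n}) x : 'rV['F_2]_n :=
  vertex_vector x *m pad + kappa x *m ker_proj.

Lemma hom_perturbK kappa x : hom_perturb kappa x *m head = vertex_vector x.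
Proof.
rewrite mulmxDl -!mulmxA mulmxBl mul1mx -mulmxA.
by rewrite pid_mx_id // pid_mx_1 !mulmx1 subrr mulmx0 addr0.
Qed.

Lemma head_ker_proj_inj (w w' : 'rV['F_2]_n) :
  w *m head = w' *m head ->
  w *m ker_proj = w' *m ker_proj -> w = w'.
Proof.
move=> eq_w; rewrite !mulmxBr !mulmx1 !mulmxA eq_w; exact: addIr.
Qed.

(** For uniform [kappa] the vector attached to the edge {x, y} is uniform in a
    fibre of the truncation, and each fibre has density 2^-d; hence it lies in
    [B] with probability at most 2^d times the density of [B].  An injection
    avoids computing the size of a fibre: translate [kappa x] by [w], and record
    the first [d] coordinates of [w] and the vector that was in [B].  The
    difference between this vector and the one attached to the edge by the
    translated [kappa] gives back the remaining part of [w]. *)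
Lemma count_bad_perturb (B : {set 'rV['F_2]_n}) (x y : V) : x != y ->
  (#|[set kappa | (hom_perturb kappa x + hom_perturb kappa y)%R \in B]| *
     #|{: 'rV['F_2]_n}| <=
   #|{: {ffun V -> 'rV['F_2]_n}}| * (2 ^ d * #|B|))%N.
Proof.
move=> xy; set bad := [set kappa | _].
pose F (q : {ffun V -> 'rV['F_2]_n} * 'rV['F_2]_n) :=
  ([ffun u => q.1 u + (if u == x then q.2 else 0)],
   (q.2 *m head, hom_perturb q.1 x + hom_perturb q.1 y)).
have F_inj : injective F.
  move=> [k w] [k' w'] [/ffunP eqk eqw eqz].
  have kE u : k u + (if u == x then w else 0) =
              k' u + (if u == x then w' else 0).
    by have := eqk u; rewrite !ffunE.
  have ky : k y = k' y.
    by have := kE y; rewrite eq_sym (negbTE xy) !addr0.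
  have kx : k x + w = k' x + w' by have := kE x; rewrite eqxx.
  have w_eq : w = w'.
    apply: head_ker_proj_inj => //; move: eqz; rewrite /hom_perturb ky.
    move/addIr/addrI => kkx; apply: (addrI (k x *m ker_proj)).
    by rewrite [in RHS]kkx -!mulmxDl kx.
  congr (_, _) => //; apply/ffunP=> u.
  by move: (kE u); rewrite w_eq => /addIr.
have -> : (2 ^ d = #|{: 'rV['F_2]_d}|)%N by rewrite card_mx mul1n card_Fp.
rewrite -[#|{: 'rV['F_2]_n}|]cardsT -[#|{: 'rV['F_2]_d}|]cardsT.
rewrite -[#|{: {ffun V -> 'rV['F_2]_n}}|]cardsT -!cardsX.
rewrite -(card_imset _ F_inj); apply: subset_leq_card.
by apply/subsetP=> _ /imsetP[[k w] /setXP[kbad _] ->]; move: kbad; rewrite !inE.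
Qed.

(** If [h] is free then each perturbed homomorphism has an edge on which [h]
    differs from [universal]; there are at most d^2 pairs of vertices, so the
    union bound over [count_bad_perturb] makes the disagreement set large. *)
Lemma universal_far_count (h : boolfun n) : Gfree G h ->
  (#|{: 'rV['F_2]_n}| <= 2 ^ d * d ^ 2 * #|[set z | universal n z != h z]|)%N.
Proof.
move=> /GfreeP free_h; set B := [set z | _].
pose bad (p : V * V) :=
  [set kappa | (hom_perturb kappa p.1 + hom_perturb kappa p.2) \in B].
pose K := {: {ffun V -> 'rV['F_2]_n}}.
have covered : [set: {ffun V -> 'rV['F_2]_n}] \subset
    \bigcup_(p | adj p.1 p.2) bad p.
  apply/subsetP=> kappa _; apply/bigcupP.
  case: (pickP [pred p : V * V | adj p.1 p.2 & kappa \in bad p]).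
    by move=> p /andP[]; exists p.
  move=> no; case: free_h; exists (hom_perturb kappa) => x y xy.
  have := no (x, y); rewrite /= xy !inE /= => /negbT; rewrite negbK => /eqP <-.
  by apply/universal_eq1; exists x, y; rewrite mulmxDl !hom_perturbK.
have K_gt0 : (0 < #|K|)%N by apply/card_gt0P; exists [ffun=> 0].
rewrite -(leq_pmul2l K_gt0).
apply: (@leq_trans (\sum_(p : V * V | adj p.1 p.2)
    #|K| * (2 ^ d * #|B|))).
  apply: (@leq_trans ((\sum_(p : V * V | adj p.1 p.2) #|bad p|) *
      #|{: 'rV['F_2]_n}|)).
    rewrite leq_mul2r -[#|K|]cardsT.
    rewrite (leq_trans (subset_leq_card covered)) ?orbT //.
    by elim/big_ind2: _ => [|m A m' A' le le'|//]; rewrite ?cards0 //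
      (leq_trans (leq_card_setU _ _)) // leq_add.
  rewrite big_distrl; apply: leq_sum => p /adj_neq.
  exact: count_bad_perturb.
rewrite sum_nat_const mulnCA leq_mul2l; apply/orP; right.
rewrite -mulnA mulnCA leq_mul2l; apply/orP; right.
by rewrite leq_mul2r (leq_trans (max_card _)) ?orbT // card_prod.
Qed.

End Averaging.

Lemma universal_far (R : realType) n : (d <= n)%N ->
  far ((2 ^ d * d ^ 2)%:R^-1 : R) (universal n) (@Gfree G n).
Proof.
move=> led h /(universal_far_count led) le_count; rewrite /dist.
have X_gt0 : (0 < #|{: 'rV['F_2]_n}|)%N by apply/card_gt0P; exists 0.
have := leq_trans X_gt0 le_count; rewrite muln_gt0 => /andP[C_gt0 _].
by rewrite ler_pdivlMr ?ltr0n // ler_pdivrMl ?ltr0n // -natrM ler_nat.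
Qed.

End Universal.

(** * Odd cycles *)

Lemma not_far_self (R : realType) n (delta : R) (F : set (boolfun n)) f :
  0 < delta -> far delta f F -> ~ F f.
Proof.
move=> delta_gt0 far_f /far_f; rewrite /dist.
have -> : [set x | f x != f x] = set0 by apply/setP=> x; rewrite !inE eqxx.
by rewrite cards0 mul0r leNgt delta_gt0.
Qed.

Lemma cycle_adj_ordS k (x : 'I_k) : (1 < k)%N -> cycle_adj x (ordS x).
Proof.
move=> k_gt1; rewrite /cycle_adj eqxx andbT.
case: (ltnP x.+1 k) => [ltx|lek]; apply/eqP => /(congr1 val) /=.
  by rewrite modn_small // => /eqP; rewrite -[_ == _]negbK neq_ltn ltnSn.
have -> : x.+1 = k by apply/eqP; rewrite eqn_leq lek ltn_ord.
by move=> x0; move: lek; rewrite x0 modnn leqNgt k_gt1.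
Qed.

(** The two additional vertices backtrack along the edge {k - 1, 0}: the closed
    walk visits 0, ..., k - 1, 0, k - 1 and returns to 0. *)
Lemma cycle_fold k (k_gt2 : (2 < k)%N) : exists h : 'I_(k + 2) -> 'I_k,
  forall x y, cycle_adj x y -> cycle_adj (h x) (h y).
Proof.
have k_gt0 : (0 < k)%N by apply: leq_trans k_gt2.
pose hn i := (if i < k then i else if i == k then 0 else k.-1)%N.
have ltk i : (hn i < k)%N.
  rewrite /hn; case: ifP => // _; case: ifP => // _; by rewrite prednK.
pose h (x : 'I_(k + 2)) := Ordinal (ltk x).
have edge x : cycle_adj (h x) (h (ordS x)).
  have [xk|kx] := ltnP x k.-1.
    have -> : h (ordS x) = ordS (h x).
      have x1k : (x.+1 < k)%N by rewrite -ltn_predRL.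
      apply: val_inj; rewrite /= /hn (ltnW x1k).
      by rewrite !modn_small ?x1k // (leq_trans x1k) ?leq_addr.
    by rewrite cycle_adj_ordS // ltnW.
  (* the remaining steps all cross the edge between [0] and [k - 1] *)
  have wrap (a b : 'I_k) : val a = k.-1 -> val b = 0%N -> cycle_adj a b.
    move=> aE bE; suff -> : b = ordS a by rewrite cycle_adj_ordS // ltnW.
    by apply: val_inj; rewrite /= bE aE prednK // modnn.
  have lt_x := ltn_ord x.
  have [xE|[xE|xE]] : val x = k.-1 \/ val x = k \/ val x = k.+1.
    by move: kx lt_x; rewrite /=; lia.
  - apply: wrap; rewrite /= /hn xE ?prednK ?modn_small ?leqnn ?ltnn ?eqxx //.
    by rewrite addn2 ltnW.
  - rewrite cycle_adj_sym; apply: wrap; rewrite /= /hn xE ?ltnn ?eqxx //.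
    by rewrite modn_small ?addn2 // ltnNge ltnW //= gtn_eqF.
  - apply: wrap; rewrite /= /hn xE; last by rewrite addn2 modnn k_gt0.
    by rewrite ltnNge ltnW //= gtn_eqF.
exists h => x y /andP[_ /orP[/eqP->|/eqP->]] //; by rewrite cycle_adj_sym.
Qed.

(** A homomorphism from C_k yields [k] edges of C_(k+2) whose incidence vectors
    sum to zero.  Every vertex then meets an even number of them, so consecutive
    edges of C_(k+2) occur equally often modulo 2: all evenly or all oddly.  The
    first is impossible because [k] is odd, the second because there are fewer
    than [k + 2] of them. *)
Lemma universal_cycle_free k n : odd k -> (2 < k)%N ->
  Gfree (cycle_graph k) (universal (cycle_graph (k + 2)) n).
Proof.
move=> odd_k k_gt2; apply/GfreeP => -[phi hom_phi].
pose m := (k + 2)%N; pose G := cycle_graph m.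
have step (j : 'I_k) : exists i : 'I_m,
    (phi j + phi (ordS j)) *m pid_mx #|vertex G| =
    vertex_vector (i : vertex G) + vertex_vector (ordS i : vertex G).
  have := hom_phi j (ordS j) (cycle_adj_ordS j (ltnW k_gt2)).
  case/universal_eq1 => x [y [/andP[_ /orP[/eqP->|/eqP->]] ->]].
    by exists x.
  by exists y; rewrite addrC.
have [s sE] := fin_all_exists step.
(* [c i] is the parity of the number of times the edge {i, i + 1} is used *)
pose c i : 'F_2 := \sum_(j < k) (s j == i)%:R.
have sum0 : \sum_(j < k) (phi j + phi (ordS j)) = 0.
  rewrite big_split /= [X in X + _](reindex_inj (@ordS_inj k)) /=.
  exact: addrr_F2.
have c_step i : c (ordS i) = c i.
  have : \sum_(j < k)
      (vertex_vector (s j : vertex G)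
        + vertex_vector (ordS (s j) : vertex G)) = 0.
    rewrite -[RHS](mul0mx _ (pid_mx #|vertex G| : 'M_(n, _))) -[in RHS]sum0.
    rewrite mulmx_suml.
    by apply: eq_bigr => j _; rewrite sE.
  move/rowP/(_ (enum_rank (ordS i : vertex G))).
  rewrite summxE mxE.
  under eq_bigr => j _ do rewrite mxE !incidence_coord !inE.
  rewrite big_split /= => c2.
  apply/eqP; rewrite -subr_eq0 (oppr_pchar2 (pchar_Fp (isT : prime 2))).
  apply/eqP; rewrite -[RHS]c2 /c; congr (_ + _); apply: eq_bigr => j _.
    by rewrite eq_sym.
  by rewrite (inj_eq (@ordS_inj _)) eq_sym.
have m_gt0 : (0 < m)%N by rewrite /m addn2.
pose i0 : 'I_m := Ordinal m_gt0.
have c_const i : c i = c i0.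
  case: i => i lt_i; elim: i lt_i => [|i IH] lt_i.
    by congr c; apply: val_inj.
  rewrite -(IH (ltnW lt_i)) -[RHS]c_step; congr c.
  by apply: val_inj; rewrite /= modn_small.
have c_total : \sum_i c i = 1.
  rewrite /c exchange_big /= (eq_bigr (fun=> 1)) => [|j _]; last first.
    rewrite (bigD1 (s j)) //= eqxx big1 ?addr0 // => i.
    by rewrite eq_sym => /negbTE->.
  rewrite sumr_const card_ord -(odd_double_half k) odd_k.
  rewrite mulrS -muln2 mulrnA -[_ *+ 2]mulr_natr.
  by rewrite (pchar_Zp (isT : (1 < 2)%N)) mulr0 addr0.
have [c0|] := eqVneq (c i0) 0.
  move: c_total; under eq_bigr => i _ do rewrite c_const c0.
  by rewrite big1.
rewrite F2_neq0 => /eqP c1.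
have : (m <= k)%N.
  rewrite -[m]card_ord -[X in (_ <= X)%N]card_ord -cardsT.
  apply: leq_trans (leq_imset_card s predT); apply: subset_leq_card.
  apply/subsetP=> i _; apply: contraT => s_i.
  have : c i = 0.
    apply: big1 => j _; case: eqP => // ji.
    by case/negP: s_i; apply/imsetP; exists j.
  by rewrite c_const c1.
by rewrite /m addn2 ltnNge leqnSn.
Qed.

Lemma cycle_free_descend k n (f : boolfun n) : (2 < k)%N ->
  Gfree (cycle_graph (k + 2)) f -> Gfree (cycle_graph k) f.
Proof.
move=> k_gt2; have [h hom_h] := cycle_fold k_gt2.
exact: (@Gfree_hom (cycle_graph (k + 2)) (cycle_graph k) h).
Qed.

Lemma cycle_separation (R : realType) k : odd k -> (2 < k)%N ->
  exists2 delta : R, 0 < delta & exists N : nat, forall n : nat, (N <= n)%N ->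
    exists g : boolfun n, Gfree (cycle_graph k) g
      /\ far delta g (@Gfree (cycle_graph (k + 2)) n).
Proof.
move=> odd_k k_gt2; pose G := cycle_graph (k + 2).
exists (2 ^ #|vertex G| * #|vertex G| ^ 2)%:R^-1.
  by rewrite invr_gt0 ltr0n muln_gt0 !expn_gt0 /= card_ord addn2.
exists #|vertex G| => n leVn; exists (universal G n).
by split; [exact: universal_cycle_free | exact: universal_far].
Qed.

(** Each property of the chain of odd cycles contains the next one
    ([cycle_free_descend]), and strictly so ([cycle_separation]). *)
Lemma odd_cycle_freeness_inj (R : realType) :
  injective (fun i => freeness (cycle_graph (i.*2 + 3))).
Proof.
have dbl i : (i.+1.*2 + 3 = (i.*2 + 3) + 2)%N by rewrite doubleS -addn2 addnAC.
have sub i m n (f : boolfun n) :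
    Gfree (cycle_graph ((m + i).*2 + 3)) f -> Gfree (cycle_graph (i.*2 + 3)) f.
  elim: m => // m IH; rewrite addSn dbl => free_f.
  by apply: IH; apply: cycle_free_descend free_f; rewrite addn3.
have neq i j : (i < j)%N ->
    freeness (cycle_graph (i.*2 + 3)) <> freeness (cycle_graph (j.*2 + 3)).
  move=> ltij eq_ij.
  have odd_k : odd (i.*2 + 3) by rewrite oddD odd_double.
  have k_gt2 : (2 < i.*2 + 3)%N by rewrite addn3.
  have [delta delta_gt0 [N sepN]] := cycle_separation R odd_k k_gt2.
  have [g [free_g far_g]] := sepN N.+1 (leqnSn N).
  apply: not_far_self delta_gt0 far_g _.
  have : freeness (cycle_graph (j.*2 + 3)) (Tagged _ g) by rewrite -eq_ij.
  by case=> _ /=; rewrite -(subnK ltij) -dbl; apply: sub.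
move=> i j eq_ij; case: (ltngtP i j) => // lt_ij.
  by case: (neq _ _ lt_ij).
by case: (neq _ _ lt_ij).
Qed.

(** * Complete graphs *)

Lemma vertex_vector_inj (V : finType) : injective (@vertex_vector V).
Proof.
move=> x y /rowP/(_ (enum_rank x)); rewrite !incidence_coord !inE eqxx.
by case: eqP.
Qed.

(** Normalise a homomorphism from K_l by sending vertex 0 to 0.  The other
    [l - 1] vertices go to pairwise different vectors, as zero is not in the
    support, and these vectors are, after truncation, incidence vectors of edges
    of K_k.  There are only 'C(k, 2) of those. *)
Lemma universal_complete_free k l n : ('C(k, 2) + 2 <= l)%N ->
  Gfree (complete_graph l) (universal (complete_graph k) n).
Proof.
case: l => [|l]; first by rewrite addn2.
rewrite addn2 ltnS => lt_l; apply/GfreeP => -[phi hom_phi].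
pose G := complete_graph k.
pose head : 'M['F_2]_(n, #|vertex G|) := pid_mx #|vertex G|.
pose psi (j : 'I_l) := (phi ord0 + phi (lift ord0 j)) *m head.
have psi_inj : injective psi.
  move=> i j eq_psi; apply/eqP; apply: contraT => ij.
  have /hom_phi/universal_eq1[x [y [/adj_neq xy /eqP]]] :
      complete_adj (lift ord0 i) (lift ord0 j).
    by rewrite /complete_adj (inj_eq lift_inj).
  rewrite -(addKr_F2 _ (phi ord0)) mulmxDl (addrC (phi _)) -/(psi i) eq_psi.
  rewrite addrr_F2 eq_sym addr_eq0_F2 (inj_eq (@vertex_vector_inj _)).
  by rewrite (negbTE xy).
have psi_edge j : psi j \in @incidence _ @: edges G.
  have /hom_phi/universal_eq1[x [y [xy psiE]]] :
      complete_adj ord0 (lift ord0 j) by rewrite /complete_adj neq_lift.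
  apply/imsetP; exists [set x; y]; first exact: mem_edge.
  by rewrite incidence_pair ?(adj_neq xy).
have : (l <= 'C(k, 2))%N; last by rewrite leqNgt lt_l.
rewrite -[l]card_ord -(card_imset predT psi_inj) -[k]card_ord -card_draws.
apply: leq_trans (subset_leq_card (_ : _ \subset @incidence _ @: edges G)) _.
  by apply/subsetP=> _ /imsetP[j _ ->].
apply: leq_trans (leq_imset_card _ _) (subset_leq_card _).
by apply/subsetP=> e /card_edge; rewrite inE => ->.
Qed.

Lemma complete_free_ascend k l n (f : boolfun n) : (k <= l)%N ->
  Gfree (complete_graph k) f -> Gfree (complete_graph l) f.
Proof.
move=> lekl.
apply: (@Gfree_hom (complete_graph k) (complete_graph l) (widen_ord lekl)).
by move=> x y; apply: contra => /eqP[xy]; apply/eqP/val_inj.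
Qed.

Lemma complete_separation (R : realType) k : (0 < k)%N ->
  exists2 delta : R, 0 < delta & forall l : nat, ('C(k, 2) + 2 <= l)%N ->
    exists N : nat, forall n : nat, (N <= n)%N ->
      exists g : boolfun n, Gfree (complete_graph l) g
        /\ far delta g (@Gfree (complete_graph k) n).
Proof.
move=> k_gt0; pose G := complete_graph k.
exists (2 ^ #|vertex G| * #|vertex G| ^ 2)%:R^-1.
  by rewrite invr_gt0 ltr0n muln_gt0 !expn_gt0 /= card_ord k_gt0.
move=> l le_l; exists #|vertex G| => n leVn; exists (universal G n).
by split; [exact: universal_complete_free | exact: universal_far].
Qed.

Theorem theorem1p2 (R : realType) :
  infinite_set [set P : property | exists G : sgraph, P = freeness G]%classic
  /\ (forall k : nat, odd k -> (3 <= k)%N ->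
        (forall (n : nat) (f : boolfun n),
           Gfree (cycle_graph (k + 2)) f -> Gfree (cycle_graph k) f)
        /\ (exists2 delta : R, 0 < delta &
              exists N : nat, forall n : nat, (N <= n)%N ->
                exists g : boolfun n,
                  Gfree (cycle_graph k) g
                  /\ far delta g (@Gfree (cycle_graph (k + 2)) n)))
  /\ (forall k l : nat, (0 < k)%N -> (k <= l)%N ->
        forall (n : nat) (f : boolfun n),
          Gfree (complete_graph k) f -> Gfree (complete_graph l) f)
  /\ (forall k : nat, (3 <= k)%N ->
        exists2 delta : R, 0 < delta &
          forall l : nat, ('C(k, 2) + 2 <= l)%N ->
            exists N : nat, forall n : nat, (N <= n)%N ->
              exists g : boolfun n,
                Gfree (complete_graph l) g
                /\ far delta g (@Gfree (complete_graph k) n)).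
Proof.
split; last split; last split.
- move=> fin; apply: infinite_nat.
  pose F i := freeness (cycle_graph (i.*2 + 3)).
  have F_inj := @odd_cycle_freeness_inj R.
  have := @finite_preimage _ _ _ F (fun i j _ _ => F_inj i j) fin.
  congr finite_set; apply/seteqP; split=> // i _.
  by exists (cycle_graph (i.*2 + 3)).
- move=> k odd_k k_ge3; split; last exact: cycle_separation.
  by move=> n f; exact: cycle_free_descend.
- by move=> k l _ lekl n f; exact: complete_free_ascend.
- by move=> k k_ge3; apply: complete_separation; apply: leq_trans k_ge3.
Qed.
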